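(* For every $n\geq 0$, the map $\psi$ restricts to a bijection from $\mathcal{C}_n$ onto the set of Motzkin paths of length $n$ that contain no occurrence of the pattern $UU$, where $\mathcal{C}_n$ is the set of Łukasiewicz paths of length $n$ having no flat step at positive height and in which every up step $U_k$ ($k\geq1$) is immediately followed by a down step $D$.
   Context: A Łukasiewicz path of length $n$ is a sequence of $n$ steps from $\{(1,i): i\geq -1\}$ starting at $(0,0)$, ending at $(n,0)$ and never going below the $x$-axis; a Motzkin path is one with steps in $\{U,F,D\}$. Write $D=(1,-1)$, $F=(1,0)$, $U=U_1=(1,1)$, $U_k=(1,k)$; $\epsilon$ is the empty path. The height of a step is the minimal ordinate of its endpoints. Every nonempty Łukasiewicz path is uniquely either $FL$ or $U_kL_1DL_2D\cdots L_kDL$ with $k\geq1$ and $L,L_1,\dots,L_k$ Łukasiewicz paths. The map $\psi$ is defined recursively by $\psi(\epsilon)=\epsilon$, $\psi(FL)=F\psi(L)$, $\psi(U_kL_1DL_2D\cdots L_kDL)=U\psi(L_1)F\psi(L_2)F\cdots F\psi(L_k)D\psi(L)$. *)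

(* Defs.v *)
From mathcomp Require Import all_boot all_order all_algebra.
From mathcomp Require Import boolp classical_sets functions.
From mathcomp Require Import zify.

Set Implicit Arguments.
Unset Strict Implicit.
Unset Printing Implicit Defensive.

Import Order.TTheory GRing.Theory Num.Theory.

Local Open Scope ring_scope.

(* A lattice path is the sequence of the vertical increments of its steps: the
   integer i stands for the step (1, i), so the abscissa after i steps is i and
   the length is the size of the sequence. *)
Definition stepD : int := -1.
Definition stepF : int := 0.
Definition stepU (k : nat) : int := k%:Z.

Definition ordinate (p : seq int) (i : nat) : int := \sum_(s <- take i p) s.

Definition step_height (p : seq int) (i : nat) : int :=
  Num.min (ordinate p i) (ordinate p i.+1).

Definition lukasiewicz (p : seq int) : Prop :=
  [/\ {in p, forall s : int, -1 <= s},
      forall i, (i <= size p)%N -> 0 <= ordinate p i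
    & ordinate p (size p) = 0].

Definition motzkin (p : seq int) : Prop :=
  lukasiewicz p /\ {in p, forall s : int, s \in [:: stepU 1; stepF; stepD]}.

Definition no_elevated_flat (p : seq int) : Prop :=
  forall i, (i < size p)%N -> nth 0 p i = stepF -> ~ 0 < step_height p i.

Definition ups_followed_by_down (p : seq int) : Prop :=
  forall i k, (i < size p)%N -> (1 <= k)%N -> nth 0 p i = stepU k ->
    (i.+1 < size p)%N /\ nth 0 p i.+1 = stepD.

Definition C_set (n : nat) : set (seq int) :=
  [set p | [/\ lukasiewicz p, size p = n, no_elevated_flat p
             & ups_followed_by_down p]].

Definition motzkin_avoiding_UU (n : nat) : set (seq int) :=
  [set p | [/\ motzkin p, size p = n & ~~ infix [:: stepU 1; stepU 1] p]].

(* Index of the first step of [q] that ends below the x-axis (or [size q]). *)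
Definition first_below (q : seq int) : nat :=
  find (fun i => ordinate q i.+1 < 0) (iota 0 (size q)).

(* [arches k (L_1 D ... L_k D L)] is [([:: L_1; ...; L_k], L)]; see [archesE]. *)
Fixpoint arches (k : nat) (q : seq int) : seq (seq int) * seq int :=
  if k is k'.+1 then
    let a := first_below q in
    let: (Ls, L) := arches k' (drop a.+1 q) in (take a q :: Ls, L)
  else ([::], q).

(* L_1 F L_2 F ... F L_k *)
Fixpoint join_flat (Ls : seq (seq int)) : seq int :=
  match Ls with
  | [::] => [::]
  | [:: L] => L
  | L :: Ls' => L ++ stepF :: join_flat Ls'
  end.

(* [m] is fuel; any [m >= size p] gives the same value ([psi_rec_fuel]).  The
   branch [Negz _] is never reached on a Lukasiewicz path. *)
Fixpoint psi_rec (m : nat) (p : seq int) : seq int :=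
  if m is m'.+1 then
    match p with
    | [::] => [::]
    | Posz 0 :: L => stepF :: psi_rec m' L
    | Posz k :: q =>
        let: (Ls, L) := arches k q in
        stepU 1 :: join_flat (map (psi_rec m') Ls) ++ stepD :: psi_rec m' L
    | Negz _ :: _ => [::]
    end
  else [::].

(* The recursive definition of psi is given by [psi_nil], [psi_flat] and
   [psi_up], which by [lukasiewicz_decomp] determine it on all Lukasiewicz
   paths. *)
Definition psi (p : seq int) : seq int := psi_rec (size p) p.

(* L_1 D L_2 D ... L_k D *)
Definition join_down (Ls : seq (seq int)) : seq int :=
  flatten [seq rcons L stepD | L <- Ls].

Lemma ordinate_cat_le p q i :
  (i <= size p)%N -> ordinate (p ++ q) i = ordinate p i.
Proof.
move=> ip; rewrite /ordinate take_cat; case: ltngtP ip => // -> _.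
by rewrite subnn take0 cats0 take_size.
Qed.

Lemma ordinate_catD p q i :
  ordinate (p ++ q) (size p + i) = ordinate p (size p) + ordinate q i.
Proof.
by rewrite /ordinate take_cat ltnNge leq_addr /= addKn big_cat /= take_size.
Qed.

Lemma ordinate0 p : ordinate p 0 = 0.
Proof. by rewrite /ordinate take0 big_nil. Qed.

Lemma ordinate_cons s p i : ordinate (s :: p) i.+1 = s + ordinate p i.
Proof. by rewrite /ordinate /= big_cons. Qed.

Lemma first_belowE L r :
  lukasiewicz L -> first_below (L ++ stepD :: r) = size L.
Proof.
case=> _ L0 LE; rewrite /first_below size_cat iotaD find_cat size_iota.
rewrite ifN /=; first by rewrite add0n -addn1 ordinate_catD LE ordinate_cons
  ordinate0 addn0.
apply/hasPn => i; rewrite mem_iota add0n /= => iL.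
by rewrite ordinate_cat_le // -leNgt L0.
Qed.

Lemma archesE Ls L : (forall L', L' \in Ls -> lukasiewicz L') ->
  arches (size Ls) (join_down Ls ++ L) = (Ls, L).
Proof.
elim: Ls => [//|L1 Ls IH] H /=.
rewrite /join_down /= cat_rcons -!catA /= first_belowE; last first.
  by apply: H; rewrite mem_head.
rewrite take_size_cat // drop_cat ltnNge leqnSn /= subSnn /= drop0 IH //.
by move=> L' L'Ls; apply: H; rewrite inE L'Ls orbT.
Qed.

Lemma size_arches k q :
  {in (arches k q).1, forall L, (size L <= size q)%N} /\
  (size (arches k q).2 <= size q)%N.
Proof.
elim: k q => [|k IH] q //=.
have := IH (drop (first_below q).+1 q); case: arches => Ls L /= [H1 H2].
have dq : (size (drop (first_below q).+1 q) <= size q)%N.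
  by rewrite size_drop leq_subr.
split=> [L'|]; last exact: leq_trans dq.
rewrite inE => /predU1P[->|/H1 /leq_trans]; last exact.
by rewrite size_take_min geq_minr.
Qed.

Lemma psi_rec_fuel m1 m2 p : (size p <= m1)%N -> (size p <= m2)%N ->
  psi_rec m1 p = psi_rec m2 p.
Proof.
elim: m1 m2 p => [|m1 IH] [|m2] [|[[|k]|k] q] //=; rewrite !ltnS => q1 q2.
  by rewrite (IH m2).
have := size_arches k.+1 q; rewrite /=; case: arches => Ls L /= [H1 H2].
rewrite (IH m2 L (leq_trans H2 q1) (leq_trans H2 q2)).
rewrite (IH m2 (take _ _)); last 2 first.
- by rewrite (leq_trans (H1 _ (mem_head _ _))).
- by rewrite (leq_trans (H1 _ (mem_head _ _))).
congr (_ :: join_flat (_ :: _) ++ _); apply/eq_in_map => L' L'Ls.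
have /H1 sL' : L' \in take (first_below q) q :: Ls by rewrite inE L'Ls orbT.
by apply: IH; apply: leq_trans sL' _.
Qed.

Lemma psi_nil : psi [::] = [::].
Proof. by []. Qed.

Lemma psi_flat L : psi (stepF :: L) = stepF :: psi L.
Proof. by []. Qed.

Lemma psi_up k Ls L : (1 <= k)%N -> size Ls = k ->
  {in Ls, forall L', lukasiewicz L'} ->
  psi (stepU k :: join_down Ls ++ L) =
  stepU 1 :: join_flat (map psi Ls) ++ stepD :: psi L.
Proof.
case: k => // k _ kE LsP; rewrite /psi /=.
have := size_arches k.+1 (join_down Ls ++ L).
have := archesE L LsP; rewrite kE /= => -> /= [H1 H2].
rewrite (@psi_rec_fuel _ (size L) L) //.
congr (_ :: join_flat _ ++ _); apply/eq_in_map => L' L'Ls.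
by apply: psi_rec_fuel => //; exact: H1.
Qed.

Lemma join_down_exists k (q : seq int) : {in q, forall s : int, -1 <= s} ->
  (forall i, (i <= size q)%N -> - k%:Z <= ordinate q i) ->
  ordinate q (size q) = - k%:Z ->
  exists Ls L, [/\ size Ls = k, {in Ls, forall L', lukasiewicz L'},
                   lukasiewicz L & q = join_down Ls ++ L].
Proof.
elim: k q => [|k IH] q q1 qk qE.
  by exists [::], q; split=> //; split=> // i /qk; rewrite oppr0.
set P := fun i => ordinate q i.+1 < 0.
have q0 : (0 < size q)%N by case: (q) qE => //; rewrite ordinate0.
have hP : has P (iota 0 (size q)).
  apply/hasP; exists (size q).-1; first by rewrite mem_iota /= add0n prednK.
  by rewrite /P prednK // qE.
set a := first_below q.
have aq : (a < size q)%N by rewrite -[X in (_ < X)%N](size_iota 0) -has_find.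
have Pa : ordinate q a.+1 < 0 by have := nth_find 0%N hP; rewrite nth_iota.
have aP (i : nat) : (i <= a)%N -> 0 <= ordinate q i.
  case: i => [|i] ia; first by rewrite ordinate0.
  have := before_find 0%N ia; rewrite nth_iota ?add0n; first by rewrite leNgt => ->.
  exact: ltn_trans aq.
have oS : ordinate q a.+1 = ordinate q a + nth 0 q a.
  by rewrite /ordinate (take_nth 0 aq) -cats1 big_cat big_seq1.
have na : -1 <= nth 0 q a :> int by apply: q1; exact: mem_nth.
have a0 : ordinate q a = 0.
  have := aP a (leqnn a); move: Pa; rewrite oS.
  move: (ordinate q a) (nth 0 q a) na => x y; lia.
have nE : nth 0 q a = stepD.
  move: Pa na; rewrite oS a0 /stepD; move: (nth 0 q a) => y; lia.
have qaE : q = rcons (take a q) stepD ++ drop a.+1 q.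
  by rewrite -nE -take_nth // cat_take_drop.
have st : size (take a q) = a by rewrite size_takel // ltnW.
have ordd i : ordinate (drop a.+1 q) i = ordinate q (a.+1 + i) + 1.
  have e : ordinate (rcons (take a q) stepD) a.+1 = -1.
    have sr : size (rcons (take a q) stepD) = a.+1 by rewrite size_rcons st.
    by rewrite -(ordinate_cat_le (drop a.+1 q)) ?sr // -qaE oS a0 nE add0r.
  have := ordinate_catD (rcons (take a q) stepD) (drop a.+1 q) i.
  by rewrite -qaE size_rcons st e => ->; rewrite addrAC addNr add0r.
have sq i : (i <= size (drop a.+1 q) -> a.+1 + i <= size q)%N.
  by rewrite size_drop leq_subRL.
have [|i /sq /qk||Ls [L [sLs LsP LP dE]]] := IH (drop a.+1 q).
- by move=> s /mem_drop /q1.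
- by rewrite ordd; lia.
- by rewrite ordd size_drop subnKC // qE; lia.
exists (take a q :: Ls), L; split=> //=; first by rewrite sLs.
  move=> L'; rewrite inE => /predU1P[->|/LsP//].
  split; first by move=> s /mem_take /q1.
    by move=> i; rewrite st => ia; rewrite /ordinate take_takel // aP.
  by rewrite st /ordinate take_takel.
by rewrite {1}qaE dE catA.
Qed.

(* The decomposition is unique: Ls and L are computed by [archesE]. *)
Lemma lukasiewicz_decomp p : lukasiewicz p ->
  [\/ p = [::],
      exists2 L, lukasiewicz L & p = stepF :: L
    | exists k Ls L, [/\ (1 <= k)%N /\ size Ls = k,
        {in Ls, forall L', lukasiewicz L'}, lukasiewicz L
      & p = stepU k :: join_down Ls ++ L]].
Proof.
case: p => [|s q] [s1 s2 s3]; first by constructor 1.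
have := s2 1%N isT; rewrite ordinate_cons ordinate0 addr0.
case: s s1 s2 s3 => // k s1 s2 s3 _.
have q1 : {in q, forall s : int, -1 <= s} by move=> s sq; apply: s1; rewrite inE sq orbT.
have qk i : (i <= size q)%N -> - k%:Z <= ordinate q i.
  by move=> iq; have := s2 i.+1 iq; rewrite ordinate_cons; lia.
have qE : ordinate q (size q) = - k%:Z.
  by move: s3 => /=; rewrite ordinate_cons => /eqP; rewrite addrC addr_eq0 => /eqP.
have [Ls [L [sLs LsP LP ->]]] := join_down_exists q1 qk qE.
case: k {s1 s2 s3 qk qE} sLs => [/size0nil ->|k sLs].
  by constructor 2; exists L.
by constructor 3; exists k.+1, Ls, L.
Qed.

(* Main.v *)
(* Both classes of paths are described by unambiguous grammars with the same
   shape.  A path of C is empty, F L, or U_k D L_2 D ... L_k D L, the factors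
   L_2, ..., L_k (which lie at positive height) being flat-free; a UU-avoiding
   Motzkin path is empty, F M, or U F M_2 F ... F M_k D M, the factors
   M_2, ..., M_k having no flat step on their ground level, since the inside of
   an arch is cut at its ground-level flat steps.  The map psi exchanges the
   two productions, so surjectivity is an induction on the second grammar and
   injectivity is its unique readability. *)
Require Import Defs.
From mathcomp Require Import all_boot all_order all_algebra.
From mathcomp Require Import boolp classical_sets functions.
From mathcomp Require Import zify.

Set Implicit Arguments.
Unset Strict Implicit.
Unset Printing Implicit Defensive.

Import Order.TTheory GRing.Theory Num.Theory.

Local Open Scope ring_scope.

(** * One-pass boolean tests of the path conditions, started at an arbitrary height *)

Fixpoint luk_from (h : int) (p : seq int) : bool :=
  if p is s :: q then [&& -1 <= s, 0 <= h + s & luk_from (h + s) q]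
  else h == 0.

Lemma luk_fromP (h : int) p : 0 <= h -> luk_from h p <->
  [/\ {in p, forall s : int, -1 <= s},
      forall i, (i <= size p)%N -> 0 <= h + ordinate p i
    & h + ordinate p (size p) = 0].
Proof.
elim: p h => [|s q IH] h h0 /=.
  rewrite ordinate0 addr0; split=> [/eqP->|[_ _ ->]//].
  by split=> // i; rewrite leqn0 => /eqP->; rewrite ordinate0.
split=> [/and3P[s1 hs /(IH _ hs)[q1 qi qE]]|[p1 pi pE]].
  split; last by rewrite ordinate_cons addrA.
    by move=> x; rewrite inE => /predU1P[->|/q1].
  move=> [_|i iq]; first by rewrite ordinate0 addr0.
  by rewrite ordinate_cons addrA qi.
have hs : 0 <= h + s by have := pi 1%N isT; rewrite ordinate_cons ordinate0 addr0.
rewrite hs (p1 _ (mem_head _ _)) /=; apply/(IH _ hs); split.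
- by move=> x xq; apply: p1; rewrite inE xq orbT.
- by move=> i iq; have := pi i.+1 iq; rewrite ordinate_cons addrA.
- by rewrite -pE ordinate_cons addrA.
Qed.

Lemma lukasiewiczE p : lukasiewicz p <-> luk_from 0 p.
Proof.
split=> [[p1 p2 p3]|/luk_fromP[]// p1 p2 p3].
  by apply/luk_fromP => //; split=> // [i|]; rewrite add0r //; apply: p2.
by rewrite add0r in p3; split=> // i /p2; rewrite add0r.
Qed.

(** A flat step has height equal to its starting ordinate, so testing the current height [h]
    suffices. *)
Fixpoint no_elevated_flat_from (h : int) (p : seq int) : bool :=
  if p is s :: q then ((s == 0) ==> (h <= 0)) && no_elevated_flat_from (h + s) q
  else true.

Lemma no_elevated_flat_fromP (h : int) p : no_elevated_flat_from h p <->
  forall i, (i < size p)%N -> nth 0 p i = stepF -> h + ordinate p i <= 0.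
Proof.
elim: p h => [|s q IH] h //=.
split=> [/andP[/implyP sh /IH qi] [_|i iq] /=|H].
- by move=> /eqP /sh; rewrite ordinate0 addr0.
- by rewrite ordinate_cons addrA; apply: qi.
apply/andP; split.
  by apply/implyP => /eqP s0; have := H 0%N isT s0; rewrite ordinate0 addr0.
by apply/IH => i iq n0; have := H i.+1 iq n0; rewrite ordinate_cons addrA.
Qed.

Lemma ordinateS p i : (i < size p)%N -> ordinate p i.+1 = ordinate p i + nth 0 p i.
Proof. by move=> ip; rewrite /ordinate (take_nth 0 ip) -cats1 big_cat big_seq1. Qed.

Lemma no_elevated_flatE p : no_elevated_flat p <-> no_elevated_flat_from 0 p.
Proof.
split=> [H|/no_elevated_flat_fromP H].
  apply/no_elevated_flat_fromP => i ip n0; rewrite add0r leNgt; apply/negP => i0.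
  by apply: (H i ip n0); rewrite /step_height ordinateS // n0 addr0 minxx.
move=> i ip n0; rewrite /step_height ordinateS // n0 addr0 minxx.
by apply/negP; rewrite -leNgt -(add0r (ordinate p i)) H.
Qed.

(** The default 0 of [head] differs from [stepD], so an up step ending the path is rejected. *)
Fixpoint ups_then_down (p : seq int) : bool :=
  if p is s :: q then ((1 <= s) ==> (head 0 q == stepD)) && ups_then_down q
  else true.

Lemma ups_followed_by_downE p : ups_followed_by_down p <-> ups_then_down p.
Proof.
elim: p => [|s q IH] //=; split=> [H|/andP[/implyP sq /IH H]].
  apply/andP; split; last first.
    by apply/IH => i k iq; apply: (H i.+1 k).
  apply/implyP; case: s H => // k H k1.
  by have [|_ /=] := H 0%N k isT _ erefl; [lia|rewrite nth0 => ->].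
move=> [|i] k iq k1 /= ; last exact: H.
move=> sk; have := sq; rewrite sk => /(_ _)/eqP; case: q {sq IH H iq} => [|x q] /=.
  by move=> /(_ k1).
by move=> ->.
Qed.

(** * The two grammars *)

(* The boolean tells whether flat steps on the x-axis are allowed. *)
Inductive Cpath : bool -> seq int -> Prop :=
| Cpath_nil b : Cpath b [::]
| Cpath_flat L : Cpath true L -> Cpath true (stepF :: L)
| Cpath_up b (Ls : seq (seq int)) L : (forall L', L' \in Ls -> Cpath false L') -> Cpath b L ->
    Cpath b (stepU (size Ls).+1 :: stepD :: join_down Ls ++ L).

(** This is [join_flat] with an extra empty first factor: that factor is the image of L_1, which is
    empty when U_k is followed by D. *)
Definition join_flats (Ms : seq (seq int)) : seq int :=
  flatten [seq stepF :: M | M <- Ms].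

Inductive Mpath : bool -> seq int -> Prop :=
| Mpath_nil b : Mpath b [::]
| Mpath_flat M : Mpath true M -> Mpath true (stepF :: M)
| Mpath_up b (Ms : seq (seq int)) M : (forall M', M' \in Ms -> Mpath false M') -> Mpath b M ->
    Mpath b (stepU 1 :: join_flats Ms ++ stepD :: M).

Lemma join_down_cons L Ls : join_down (L :: Ls) = L ++ stepD :: join_down Ls.
Proof. by rewrite /join_down /= cat_rcons. Qed.

Lemma join_down_cat Ls1 Ls2 : join_down (Ls1 ++ Ls2) = join_down Ls1 ++ join_down Ls2.
Proof. by rewrite /join_down map_cat flatten_cat. Qed.

Lemma join_flats_cons M Ms : join_flats (M :: Ms) = stepF :: M ++ join_flats Ms.
Proof. by []. Qed.

(** * The grammar [Cpath] describes the Łukasiewicz class *)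

Definition Cscan (h : int) p :=
  [&& luk_from h p, no_elevated_flat_from h p & ups_then_down p].

Lemma Cscan_cons h s q : Cscan h (s :: q) =
  [&& -1 <= s, 0 <= h + s, (s == 0) ==> (h <= 0),
      (1 <= s) ==> (head 0 q == stepD) & Cscan (h + s) q].
Proof.
rewrite /Cscan /=.
by case: (luk_from _ _); case: (no_elevated_flat_from _ _);
  case: (ups_then_down _); case: (_ ==> _); case: (_ ==> _);
  case: (-1 <= _); case: (0 <= _).
Qed.

Lemma Cscan_down (h : int) q : 0 <= h -> Cscan (h + 1) (stepD :: q) = Cscan h q.
Proof. by move=> h0; rewrite Cscan_cons /stepD addrK h0. Qed.

Lemma Cscan_up (h : int) k q : 0 <= h ->
  Cscan h (stepU k.+1 :: stepD :: q) = Cscan (h + k%:Z) q.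
Proof.
move=> h0; rewrite Cscan_cons /=.
have -> : 0 <= h + stepU k.+1 by rewrite /stepU; lia.
have -> : h + stepU k.+1 = h + k%:Z + 1 by rewrite /stepU; lia.
by rewrite Cscan_down ?eqxx ?implybT //; lia.
Qed.

(** The continuation [t] allows a factor to be read in the middle of a path. Ground-level flat steps
    of [p] then sit at height [h], whence the condition [b -> h = 0]. *)
Lemma Cscan_cat b p (h : int) t : Cpath b p -> 0 <= h -> (b -> h = 0) ->
  Cscan h t -> Cscan h (p ++ t).
Proof.
move=> Cp; elim: Cp h t => {b p} [b|L _ IH|b Ls L _ IHLs _ IH] h t h0 bh ht //=.
  by rewrite (bh isT) in ht *; rewrite Cscan_cons /=; apply: IH.
rewrite -catA Cscan_up //.
(* The scan is now at height [h + size Ls]; the D closing each factor lowers it by one, so that [L]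
   is read at height [h]. *)
elim: Ls IHLs => [|L1 Ls IHl] IHLs.
  by rewrite addr0 /=; apply: IH.
rewrite join_down_cons -catA /=; apply: (IHLs L1) => //; first exact: mem_head.
  by lia.
rewrite -addn1 PoszD addrA Cscan_down; last by lia.
by apply: IHl => L' L'Ls; apply: IHLs; rewrite inE L'Ls orbT.
Qed.

(** The path is cut at its first descents below h, h-1, ..., 1. The factors before these cuts start
    at positive height, so they have no ground-level flat step. The induction is on length because
    an up step is consumed together with its D. *)
Lemma Cscan_parse (h : nat) p : Cscan h p -> exists Ls L,
  [/\ size Ls = h, forall L', L' \in Ls -> Cpath false L', Cpath true L
    & p = join_down Ls ++ L].
Proof.
have [n] := ubnP (size p); elim: n p h => // n IH [|s q] h /=.
  move=> _ /and3P[/eqP[->] _ _]; exists [::], [::]; split=> //; exact: Cpath_nil.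
rewrite ltnS Cscan_cons => qn /and5P[s1 hs /implyP sh /implyP sq qs].
have [s0|s0|s0] := ltgtP s 0.
- have sE : s = stepD by rewrite /stepD; lia.
  case: h hs {sh} qs => [|h] hs; first by lia.
  have -> : h.+1%:Z + s = h by rewrite sE /stepD; lia.
  move=> /IH[//|Ls [L [sLs LsC LC ->]]].
  exists ([::] :: Ls), L; split=> //; first by rewrite /= sLs.
    by move=> L'; rewrite inE => /predU1P[->|/LsC//]; exact: Cpath_nil.
  by rewrite join_down_cons sE.
- case: q qn sq qs => [|x r] /= qn sq; first by have := sq s0.
  have /eqP -> := sq s0; rewrite Cscan_cons => /and5P[_ _ _ _].
  case: s {s1 hs sh sq} s0 => [[|k]|] // s0.
  have -> : h%:Z + k.+1%:Z + stepD = (k + h)%N :> int by rewrite /stepD; lia.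
  move=> /IH[|Ls [L [sLs LsC LC ->]]]; first exact: ltnW.
  (* The first [k] factors complete the arch opened by the up step and its D. The arch is then glued
     in front of the next factor, or of [L] when [h] is 0. *)
  have kLs : size (take k Ls) = k by rewrite size_takel // sLs leq_addr.
  have CA L' : L' \in take k Ls -> Cpath false L' by move=> /mem_take /LsC.
  have : forall L', L' \in drop k Ls -> Cpath false L' by move=> L' /mem_drop /LsC.
  have : size (drop k Ls) = h by rewrite size_drop sLs addKn.
  rewrite -{3}(cat_take_drop k Ls) join_down_cat -catA.
  have -> : k.+1%:Z = stepU (size (take k Ls)).+1 by rewrite kLs.
  move: (take k Ls) (drop k Ls) CA => As [|B Bs] CA sB CB.
    exists [::], (stepU (size As).+1 :: stepD :: join_down As ++ L); split=> //.
    exact: Cpath_up.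
  exists ((stepU (size As).+1 :: stepD :: join_down As ++ B) :: Bs), L; split=> //.
    move=> L'; rewrite inE => /predU1P[->|L'B]; last by apply: CB; rewrite inE L'B orbT.
    by apply: Cpath_up => //; apply: CB; rewrite mem_head.
  by rewrite !join_down_cons /= -!catA.
- have h0 : h = 0%N by have := sh (introT eqP s0); lia.
  move: qs; rewrite s0 addr0 h0 => /IH[//|Ls [L [/size0nil -> _ LC ->]]].
  by exists [::], (stepF :: L); split=> //; exact: Cpath_flat.
Qed.

Lemma C_setE n p : C_set n p <-> Cpath true p /\ size p = n.
Proof.
split=> [[/lukasiewiczE lp pn /no_elevated_flatE fp /ups_followed_by_downE up]|[Cp pn]].
  have /Cscan_parse[Ls [L [/size0nil -> _ LC pL]]] : Cscan 0%N p by apply/and3P.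
  by rewrite pL in pn *.
have /and3P[] : Cscan 0 p by rewrite -(cats0 p); apply: Cscan_cat Cp _ _ _.
by move=> *; split=> //;
  [apply/lukasiewiczE|apply/no_elevated_flatE|apply/ups_followed_by_downE].
Qed.

Lemma Cpath_lukasiewicz b p : Cpath b p -> lukasiewicz p.
Proof.
move=> Cp; apply/lukasiewiczE.
by have /and3P[] : Cscan 0 p by rewrite -(cats0 p); apply: Cscan_cat Cp _ _ _.
Qed.

(** * The grammar [Mpath] describes the UU-avoiding Motzkin paths *)

Definition Mscan (h : int) p :=
  [&& luk_from h p, all [in [:: stepU 1; stepF; stepD]] p
    & ~~ infix [:: stepU 1; stepU 1] p].

Lemma Mscan_cons h s q : Mscan h (s :: q) =
  [&& s \in [:: stepU 1; stepF; stepD], 0 <= h + s,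
      (s == 1) ==> (head 0 q != 1) & Mscan (h + s) q].
Proof.
have [sS|sS] := boolP (s \in _); last by rewrite /Mscan /= (negPf sS) /= !andbF.
rewrite /Mscan /= sS.
have -> : -1 <= s by move: sS; rewrite !inE => /or3P[] /eqP ->.
rewrite negb_or /=; have -> : (stepU 1 == s) && prefix [:: stepU 1] q =
    (s == 1) && (head 0 q == 1).
  rewrite eq_sym; congr andb; case: q => //= x q.
  by rewrite prefix0s andbT eq_sym.
rewrite implybE negb_and.
by case: (luk_from _ _); case: (all _ _); case: (infix _ _);
  case: (_ || _); case: (0 <= _).
Qed.

Lemma Mscan_cat b p (h : int) t : Mpath b p -> 0 <= h -> Mscan h t -> Mscan h (p ++ t).
Proof.
move=> Mp; elim: Mp h t => {b p} [b|M _ IH|b Ms M _ IHMs _ IH] h t h0 ht //=.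
  by rewrite Mscan_cons /= addr0 h0 /=; apply: IH.
(* The inside of an arch begins with F, or is empty and followed by D, so the opening U creates no
   UU. *)
have hD : head 0 (join_flats Ms ++ stepD :: M ++ t) != 1 by case: (Ms).
rewrite -catA /= Mscan_cons hD /=.
apply/andP; split; first by rewrite /stepU; lia.
have h1 : 0 <= h + stepU 1 by rewrite /stepU; lia.
elim: Ms IHMs {hD} => [|M1 Ms IHl] IHMs.
  by rewrite Mscan_cons /= /stepU /stepD addrK h0 /=; apply: IH.
rewrite join_flats_cons /= Mscan_cons /= addr0 h1 /= -catA.
apply: (IHMs M1) => //; first exact: mem_head.
by apply: IHl => M' M'Ms; apply: IHMs; rewrite inE M'Ms orbT.
Qed.

(** Reading from the left, a ground-level flat step opens a new piece, while an arch is prepended to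
    the first piece [M0]. *)
Lemma Mpath_cut b M : Mpath b M -> exists M0 Ms,
  [/\ Mpath false M0, forall M', M' \in Ms -> Mpath false M'
    & M = M0 ++ join_flats Ms].
Proof.
elim=> {b M} [b|M _ [M0 [Ms [M0P MsP ->]]]|b Ns N NsP _ _ [M0 [Ms [M0P MsP ->]]]].
- by exists [::], [::]; split=> //; exact: Mpath_nil.
- exists [::], (M0 :: Ms); split=> //; first exact: Mpath_nil.
  by move=> M'; rewrite inE => /predU1P[->|/MsP].
- exists (stepU 1 :: join_flats Ns ++ stepD :: M0), Ms; split=> //.
    exact: Mpath_up.
  by rewrite /= -catA.
Qed.

Lemma Mpath_no_head_up b M : Mpath b M -> head 0 M != 1 ->
  exists2 Ms, forall M', M' \in Ms -> Mpath false M' & M = join_flats Ms.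
Proof.
case=> {b M} // [_ _|M /Mpath_cut[M0 [Ms [M0P MsP ->]]] _]; first by exists [::].
by exists (M0 :: Ms) => // M'; rewrite inE => /predU1P[->|/MsP].
Qed.

(** The cuts are the same first descents as in [Cscan_parse], but flat steps may occur at every
    height, so the factors are only [Mpath true]. *)
Lemma Mscan_parse (h : nat) p : Mscan h p -> exists Ms M,
  [/\ size Ms = h, forall M', M' \in Ms -> Mpath true M', Mpath true M
    & p = join_down Ms ++ M].
Proof.
elim: p h => [|s q IH] h /=.
  move=> /and3P[/eqP[->] _ _]; exists [::], [::]; split=> //; exact: Mpath_nil.
rewrite Mscan_cons => /and4P[sS hs /implyP sq].
move: sS; rewrite !inE => /or3P[] /eqP sE.
- have -> : h%:Z + s = h.+1 by rewrite sE /stepU; lia.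
  move=> /IH[As [M [+ + MP]]]; case: As => [//|A As] [sA] AP qE.
  (* [A] is the inside of the arch opened by [s]. Avoiding UU prevents it from starting with U, so
     it is empty or starts with F and is cut into flat-prefixed pieces. *)
  have hA : head 0 A != 1.
    by have := sq (introT eqP sE); rewrite qE join_down_cons; case: (A).
  have [Ns NsP AE] := Mpath_no_head_up (AP _ (mem_head _ _)) hA.
  have {}AP M' : M' \in As -> Mpath true M' by move=> M'A; apply: AP; rewrite inE M'A orbT.
  rewrite qE sE join_down_cons AE; case: As sA AP {qE} => [|B Bs] sA AP.
    exists [::], (stepU 1 :: join_flats Ns ++ stepD :: M); split=> //.
      exact: Mpath_up.
    by rewrite /= -catA.
  exists ((stepU 1 :: join_flats Ns ++ stepD :: B) :: Bs), M; split=> //.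
    move=> M'; rewrite inE => /predU1P[->|M'B]; last by apply: AP; rewrite inE M'B orbT.
    by apply: Mpath_up => //; apply: AP; rewrite mem_head.
  by rewrite !join_down_cons /= -!catA /= -!catA.
- rewrite sE addr0 => /IH[[|A As] [M [sA AP MP ->]]].
    by exists [::], (stepF :: M); split=> //; exact: Mpath_flat.
  exists ((stepF :: A) :: As), M; split=> //.
  move=> M'; rewrite inE => /predU1P[->|M'A]; last by apply: AP; rewrite inE M'A orbT.
  by apply: Mpath_flat; apply: AP; rewrite mem_head.
- case: h hs => [|h] hs; first by move: hs; rewrite sE.
  have -> : h.+1%:Z + s = h by rewrite sE /stepD; lia.
  move=> /IH[Ms [M [sM MsP MP ->]]].
  exists ([::] :: Ms), M; split=> //; first by rewrite /= sM.
    by move=> M'; rewrite inE => /predU1P[->|/MsP//]; exact: Mpath_nil.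
  by rewrite join_down_cons sE.
Qed.

Lemma motzkin_avoiding_UUE n p :
  motzkin_avoiding_UU n p <-> Mpath true p /\ size p = n.
Proof.
split=> [[[/lukasiewiczE lp /allP ap] pn up]|[Mp pn]].
  have /Mscan_parse[Ms [M [/size0nil -> _ MP pM]]] : Mscan 0%N p by apply/and3P.
  by rewrite pM in pn *.
have /and3P[/lukasiewiczE lp /allP ap up] : Mscan 0 p.
  by rewrite -(cats0 p); apply: Mscan_cat Mp _ _.
by split.
Qed.

(** * The map [psi] carries one grammar to the other bijectively *)

Lemma join_flat_cons M Ms : join_flat (M :: Ms) = M ++ join_flats Ms.
Proof.
elim: Ms M => [|N Ms IH] M; first by rewrite cats0.
by rewrite join_flats_cons -IH.
Qed.

Lemma psi_Cpath_up Ls L : (forall L', L' \in Ls -> Cpath false L') ->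
  psi (stepU (size Ls).+1 :: stepD :: join_down Ls ++ L) =
  stepU 1 :: join_flats (map psi Ls) ++ stepD :: psi L.
Proof.
(* The D right after the up step means that the first factor L_1 is empty. *)
move=> LsC; have := @psi_up (size Ls).+1 ([::] :: Ls) L isT erefl.
rewrite join_down_cons map_cons join_flat_cons psi_nil => -> //.
move=> L'; rewrite inE => /predU1P[->|/LsC]; last exact: Cpath_lukasiewicz.
by apply/lukasiewiczE.
Qed.

Lemma psi_Mpath b p : Cpath b p -> Mpath b (psi p) /\ size (psi p) = size p.
Proof.
elim=> {b p} [b|L _ [MP sP]|b Ls L LsC IHLs _ [MP sP]].
- by split=> //; exact: Mpath_nil.
- by rewrite psi_flat /= sP; split=> //; exact: Mpath_flat.
rewrite psi_Cpath_up //; split.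
  by apply: Mpath_up => // _ /mapP[L' /IHLs[? _] ->].
(* Each factor costs one extra step on either side: a D after it in the source, an F before it in
   the image. *)
rewrite /= !size_cat /= sP addnS; congr (_.+2); congr addn.
elim: Ls IHLs {LsC} => // L1 Ls IHl IHLs.
rewrite map_cons join_flats_cons join_down_cons /= !size_cat /= IHl; last first.
  by move=> L' L'Ls; apply: IHLs; rewrite inE L'Ls orbT.
by have [_ ->] := IHLs _ (mem_head _ _); rewrite addnS.
Qed.

(** A derivation of [M] is pulled back production by production; the number of pieces inside an arch
    determines the up step. *)
Lemma psi_surj b M : Mpath b M -> exists2 p, Cpath b p & psi p = M.
Proof.
elim=> {b M} [b|M _ [p pC <-]|b Ms M _ IHMs _ [p pC <-]].
- by exists [::]; first exact: Cpath_nil.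
- by exists (stepF :: p); first exact: Cpath_flat.
have [Ls LsC <-] : exists2 Ls, forall L', L' \in Ls -> Cpath false L' & map psi Ls = Ms.
  elim: Ms IHMs => [|M1 Ms IHl] IHMs; first by exists [::].
  have [|Ls LsC <-] := IHl.
    by move=> M' M'Ms; apply: IHMs; rewrite inE M'Ms orbT.
  have [L LC <-] := IHMs _ (mem_head _ _); exists (L :: Ls) => // L'.
  by rewrite inE => /predU1P[->|/LsC].
exists (stepU (size Ls).+1 :: stepD :: join_down Ls ++ p); first exact: Cpath_up.
exact: psi_Cpath_up.
Qed.

(* Generalizing over the continuations t and t', which must not begin with a
   step that could extend the parse, makes unique readability inductive. *)
Lemma psi_cat_inj b p p' t t' : Cpath b p -> Cpath b p' ->
  head stepD t != 1 -> (b -> head stepD t != 0) ->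
  head stepD t' != 1 -> (b -> head stepD t' != 0) ->
  psi p ++ t = psi p' ++ t' -> p = p' /\ t = t'.
Proof.
move=> Cp; elim: Cp p' t t' => {b p} [b|L LC IH|b Ls L LsC IHLs LC IH] p' t t'.
- case=> {b p'} [b|L' _|b Ls' L' Ls'C _] t1 t0 _ _ //.
    by rewrite psi_nil psi_flat /= => tE; move: (t0 isT); rewrite tE.
  by rewrite psi_nil psi_Cpath_up //= => tE; move: t1; rewrite tE.
- move E : true => b Cp'; case: Cp' E => {b p'} [b|L' L'C|b Ls' L' Ls'C _] bE t1 t0 t1' t0'.
  + by rewrite psi_nil psi_flat /= => tE; move: (t0'); rewrite -bE -tE => /(_ isT).
  + rewrite !psi_flat /= => -[] E.
    by have [-> ->] := IH _ _ _ L'C t1 t0 t1' t0' E.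
  + by rewrite psi_flat psi_Cpath_up.
- move=> Cp'; case: Cp' LC IH => {b p'} [b|L' L'C|b Ls' L' Ls'C L'C] LC IH t1 t0 t1' t0'.
  + by rewrite psi_nil psi_Cpath_up //= => tE; move: t1'; rewrite -tE.
  + by rewrite psi_flat psi_Cpath_up.
  rewrite !psi_Cpath_up //= -!catA /= => -[] E.
  suff [-> E'] : Ls = Ls' /\ psi L ++ t = psi L' ++ t'.
    by have [-> ->] := IH _ _ _ L'C t1 t0 t1' t0' E'.
  (* Lists of different lengths are excluded because F announces another factor while D closes the
     arch. *)
  elim: Ls Ls' IHLs Ls'C E {LsC} => [|A As IHl] [|A' As'] IHLs AC //.
    by rewrite /= => -[->].
  rewrite !map_cons !join_flats_cons /= -!catA => -[] E.
  (* What follows a factor begins with F or D. An initial F is harmless because factors are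
     [Cpath false], which makes the condition on flat steps vacuous. *)
  have hD (Ns : seq (seq int)) r : head stepD (join_flats Ns ++ stepD :: r) != 1.
    by case: Ns.
  have nF (c : bool) : false -> c by [].
  have A'C := AC _ (mem_head _ _).
  have [-> E'] := IHLs _ (mem_head _ _) _ _ _ A'C (hD _ _) (nF _) (hD _ _) (nF _) E.
  have [||-> ->] := IHl _ _ _ E' => // M' M'A.
    by apply: IHLs; rewrite inE M'A orbT.
  by apply: AC; rewrite inE M'A orbT.
Qed.

Theorem theorem9 (n : nat) : set_bij (C_set n) (motzkin_avoiding_UU n) psi.
Proof.
split.
- move=> p /C_setE[/psi_Mpath[Mp sp] pn]; apply/motzkin_avoiding_UUE.
  by rewrite sp.
- move=> p p'; rewrite !inE => /C_setE[Cp _] /C_setE[Cp' _] E.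
  (* The default [stepD] of [head] makes empty continuations admissible. *)
  have := @psi_cat_inj true p p' [::] [::] Cp Cp' isT (fun=> isT) isT (fun=> isT).
  by rewrite E => -[].
- move=> M /motzkin_avoiding_UUE[/psi_surj[p pC <-] sM]; exists p => //.
  by apply/C_setE; split=> //; rewrite -sM; have [_ ->] := psi_Mpath pC.
Qed.
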